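(* Let $p$ be a prime and let $G$ be a finitely generated nilpotent group. Then $G$ is conjugacy $\mathcal{F}_p$-separable if and only if its torsion subgroup $\tau(G)$ is a $p$-group and the quotient group $G/\tau(G)$ is abelian.
   Context: $\mathcal{F}_p$ denotes the class of all finite $p$-groups. A group $G$ is called conjugacy $\mathcal{K}$-separable (for a class of groups $\mathcal{K}$) if whenever elements $a,b\in G$ are not conjugate in $G$, there is a homomorphism $\varphi$ of $G$ onto a group $X$ belonging to $\mathcal{K}$ such that $a\varphi$ and $b\varphi$ are not conjugate in $X$. $\tau(G)$ denotes the set of elements of finite order of $G$ (a subgroup since $G$ is nilpotent). *)

(* Defs.v *)
From mathcomp Require Import all_boot all_fingroup all_solvable.
From Stdlib Require Lists.List.
Set Implicit Arguments. Unset Strict Implicit. Unset Printing Implicit Defensive.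

Record Grp := {
  carrier :> Type;
  gmul : carrier -> carrier -> carrier;
  gone : carrier;
  ginv : carrier -> carrier;
  gmulA : forall x y z, gmul x (gmul y z) = gmul (gmul x y) z;
  gmul1 : forall x, gmul gone x = x;
  gmulV : forall x, gmul (ginv x) x = gone
}.

Section GrpDefs.
Variable G : Grp.

Fixpoint gpow (x : G) (n : nat) : G :=
  match n with 0 => gone G | n'.+1 => gmul x (gpow x n') end.

Definition gcomm (x y : G) : G :=
  gmul (gmul (ginv x) (ginv y)) (gmul x y).

Fixpoint lcomm (x : nat -> G) (n : nat) : G :=
  match n with 0 => x 0 | n'.+1 => gcomm (lcomm x n') (x n) end.

(* G is nilpotent: gamma_{c+1}(G) = 1 for some c, i.e. all left-normed
   commutators of weight c+1 are trivial. *)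
Definition nilpotent_grp : Prop :=
  exists c : nat, forall x : nat -> G, lcomm x c = gone G.

Inductive in_gen (s : seq G) : G -> Prop :=
| gen_base x : Stdlib.Lists.List.In x s -> in_gen s x
| gen_one : in_gen s (gone G)
| gen_mul x y : in_gen s x -> in_gen s y -> in_gen s (gmul x y)
| gen_inv x : in_gen s x -> in_gen s (ginv x).

Definition fin_gen : Prop := exists s : seq G, forall g : G, in_gen s g.

Definition torsion_elt (x : G) : Prop := exists n, 0 < n /\ gpow x n = gone G.

Definition conj_in (a b : G) : Prop := exists g : G, gmul (gmul (ginv g) a) g = b.

Definition torsion_pgroup (p : nat) : Prop :=
  forall x : G, torsion_elt x -> exists k, gpow x (p ^ k) = gone G.

Definition abelian_mod_torsion : Prop :=
  forall x y : G, torsion_elt (gcomm x y).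

Definition is_hom (gT : finGroupType) (f : G -> gT) : Prop :=
  forall x y, f (gmul x y) = (f x * f y)%g.

Definition conj_Fp_separable (p : nat) : Prop :=
  forall a b : G, ~ conj_in a b ->
    exists (gT : finGroupType) (f : G -> gT),
      [/\ is_hom f, (forall y : gT, exists x : G, f x = y),
          pgroup p [set: gT] &
          ~ (exists z : gT, ((f a) ^ z)%g = f b)].
End GrpDefs.

(* Main.v *)
Require Import Defs.
From mathcomp Require Import all_boot all_fingroup all_solvable.
From HB Require Import structures.
From mathcomp Require Import boolp zify.
(** A finitely generated nilpotent group has a central series with cyclic
    factors, and induction along such a series gives the structure needed:
    torsion elements form a subgroup of bounded exponent, some power n > 0
    satisfies (u t)^n = u^n for all u and all torsion t, and an element having
    q^m-th roots for every m is torsion.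

    If G' is torsion and the torsion is p-primary, n can be a power of p, so x^n
    is central for all x and the centre Z has finite index. A conjugacy class is
    then finite, and for large m the finite p-quotient of G by the p^m-th powers
    of elements of Z separates b from all the conjugates of a.

    Conversely, if some commutator has infinite order, there is v such that all
    [v, g] are central and some [v, g] has infinite order. With q = p + 1, some
    w = [v, g] is not of the form [v, h]^q, since otherwise every [v, g] would have
    q^m-th roots. Then v^q and v^q w are not conjugate, but they become so in every
    finite p-group, where q is invertible modulo the order of w. *)
Set Implicit Arguments. Unset Strict Implicit. Unset Printing Implicit Defensive.
Local Open Scope group_scope.

(** * Structures of type [Grp] as library groups *)

Lemma gmulVr (G : Grp) : right_inverse (gone G) (@ginv G) (@gmul G).
Proof.
move=> x; rewrite -[LHS]gmul1 -{1}(gmulV (ginv x)) -gmulA [gmul (ginv x) _]gmulA.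
by rewrite gmulV gmul1 gmulV.
Qed.

Lemma gmulr1 (G : Grp) : right_id (gone G) (@gmul G).
Proof. by move=> x; rewrite -(gmulV x) gmulA gmulVr gmul1. Qed.

(** Equality and choice come from classical axioms. All the group theory below is stated for
    [groupType] and carried back to [Grp] at the end. *)
HB.instance Definition _ (G : Grp) := gen_eqMixin (carrier G).
HB.instance Definition _ (G : Grp) := gen_choiceMixin (carrier G).
HB.instance Definition _ (G : Grp) := isGroup.Build (carrier G)
  (@gmulA G) (@gmul1 G) (@gmulr1 G) (@gmulV G) (@gmulVr G).

(** * Normal subgroups as predicates, and their quotients *)

Record nsubgroup (G : groupType) (S : G -> Prop) : Prop := NSubgroup {
  nsub1 : S 1;
  nsubM : forall x y, S x -> S y -> S (x * y);
  nsubV : forall x, S x -> S x^-1;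
  nsubJ : forall x y, S x -> S (x ^ y) }.

(** Elements of Q are left cosets taken as predicates, so by extensionality their equality is
    [S (x^-1 * y)]. The operations act on chosen representatives; normality makes them independent
    of the choice. *)
Lemma nsubgroup_quotient (G : groupType) (S : G -> Prop) : nsubgroup S ->
  exists (Q : groupType) (f : UMagmaMorphism.type G Q),
    (forall q, exists x, f x = q) /\ (forall x, f x = 1 <-> S x).
Proof.
move=> nS; pose coset (x y : G) := S (x^-1 * y).
have cosetE x y : coset x = coset y <-> S (x^-1 * y).
  split=> [Exy|Sxy].
    have: coset y y by rewrite /coset mulVg; apply: nsub1.
    by rewrite -[coset y]Exy.
  apply/funext=> z; apply/propext; split=> Sz; rewrite /coset.
    have -> : y^-1 * z = (x^-1 * y)^-1 * (x^-1 * z).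
      by rewrite invgM invgK mulgA mulgK.
    by apply: (nsubM nS) => //; apply: (nsubV nS).
  by rewrite -(mulVKg y z) mulgA; apply: (nsubM nS).
pose Q := {P : G -> Prop | exists x, coset x = P}.
pose pi (x : G) : Q := exist _ (coset x) (ex_intro _ x erefl).
have piE x y : pi x = pi y <-> S (x^-1 * y).
  split=> [[/cosetE]//|/cosetE Exy]; exact: eq_exist.
pose rep (q : Q) := projT1 (cid (svalP q)).
have repK q : pi (rep q) = q.
  have: coset (rep q) = sval q by rewrite /rep; case: cid.
  by case: q (rep q) => P eP x /= Ex; apply: eq_exist.
have piM x y x' y' : pi x = pi x' -> pi y = pi y' -> pi (x * y) = pi (x' * y').
  move=> /piE Sx /piE Sy; apply/piE; rewrite invgM.
  have -> : y^-1 * x^-1 * (x' * y') = (x^-1 * x') ^ y * (y^-1 * y').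
    by rewrite conjgE !mulgA mulgK.
  by apply: (nsubM nS) => //; apply: (nsubJ nS).
have piV x y : pi x = pi y -> pi x^-1 = pi y^-1.
  move=> /piE Sxy; apply/piE; rewrite invgK.
  have -> : x * y^-1 = (x^-1 * y)^-1 ^ y^-1 by rewrite conjgE !gnorm.
  by apply: (nsubJ nS); apply: (nsubV nS).
pose mul p q := pi (rep p * rep q); pose inv p := pi (rep p)^-1.
have piMm x y : pi (x * y) = mul (pi x) (pi y) by apply: piM; rewrite repK.
have piVm x : pi x^-1 = inv (pi x) by apply: piV; rewrite repK.
have mulA : associative mul.
  move=> p q r; rewrite -(repK p) -(repK q) -(repK r) -!piMm.
  by rewrite mulgA.
have mul1 : left_id (pi 1) mul.
  by move=> p; rewrite -(repK p) -piMm mul1g.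
have mulr1 : right_id (pi 1) mul.
  by move=> p; rewrite -(repK p) -piMm mulg1.
have mulV : left_inverse (pi 1) inv mul.
  by move=> p; rewrite -(repK p) -piVm -piMm mulVg.
have mulVr : right_inverse (pi 1) inv mul.
  by move=> p; rewrite -(repK p) -piVm -piMm mulgV.
pose C := HB.pack_for choiceType Q (gen_eqMixin Q) (gen_choiceMixin Q).
pose M := isGroup.Build C mulA mul1 mulr1 mulV mulVr.
pose QG := HB.pack_for groupType Q C M.
have pi_morph : monoid_morphism (pi : G -> QG) by split.
pose f := HB.pack_for (UMagmaMorphism.type G QG) (pi : G -> QG)
  (isUMagmaMorphism.Build G QG pi pi_morph).
exists QG, f; split=> [q|x]; first by exists (rep q); apply: repK.
split=> [E|Sx].
  by have /piE := E; rewrite mulg1 => /(nsubV nS); rewrite invgK.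
by apply/piE; rewrite mulg1; apply: (nsubV nS).
Qed.

Lemma finGroupType_of (Q : groupType) (R : seq Q) : (forall q, q \in R) ->
  exists (gT : finGroupType) (f : Q -> gT),
    {morph f : x y / x * y >-> x * y} /\ bijective f.
Proof.
move=> RP.
have finR : Finite.axiom (undup R).
  by move=> q; rewrite count_uniq_mem ?undup_uniq // mem_undup RP.
have pcQ : pcancel (fun q => index q R) (fun i => Some (nth 1 R i)).
  by move=> q; rewrite nth_index.
pose C := HB.pack_for finType Q (PCanIsCountable pcQ) (isFinite.Build Q finR).
have mulA : associative (@mul Q) by exact: mulgA.
have mul1 : left_id 1 (@mul Q) by exact: mul1g.
have mulV : left_inverse 1 (@inv Q) (@mul Q) by exact: mulVg.
pose gT := HB.pack_for finGroupType Q C (Finite_isGroup.Build C mulA mul1 mulV).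
by exists gT, id; split=> //; exists id.
Qed.

(* [gmulfM] rewrites to images under the coercion to [Multiplicative.type], which
   the lemmas about [UMagmaMorphism.type] do not match. *)
Lemma umulfM (G Q : groupType) (f : UMagmaMorphism.type G Q) x y :
  f (x * y) = f x * f y.
Proof. exact: gmulfM. Qed.

Lemma nsubgroup_comm (G Q : groupType) (S : G -> Prop)
    (f : UMagmaMorphism.type G Q) x y :
  (forall x, f x = 1 <-> S x) -> S [~ x, y] <-> commute (f x) (f y).
Proof.
by move=> fS; rewrite -fS gmulfR; split=> [/eqP/commgP|/commgP/eqP].
Qed.

(** The set in question is the preimage of the centre of G/S. *)
Lemma central_mod_nsubgroup (G : groupType) (S : G -> Prop) :
  nsubgroup S -> nsubgroup (fun u => forall x, S [~ u, x]).
Proof.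
move=> nS; have [Q [f [_ fS]]] := nsubgroup_quotient nS.
split=> [x|u v cu cv x|u cu x|u v cu x]; apply/(nsubgroup_comm _ _ fS).
- by rewrite gmulf1; apply/commute_sym/commute1.
- rewrite umulfM; apply/commute_sym/commuteM; apply/commute_sym.
    by apply/(nsubgroup_comm _ _ fS).
  by apply/(nsubgroup_comm _ _ fS).
- rewrite gmulfV; apply/commute_sym/commuteV/commute_sym.
  by apply/(nsubgroup_comm _ _ fS).
- have /conjg_fixP/eqP : [~ f u, f v] == 1.
    by apply/commgP/(nsubgroup_comm _ _ fS).
  rewrite gmulfJ => /eqP ->; exact/(nsubgroup_comm _ _ fS).
Qed.

(** * Central series with cyclic factors *)

Lemma commute_expg (G : groupType) (z : G) m n : commute (z ^+ m) (z ^+ n).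
Proof. by rewrite /commute -!expgnDr addnC. Qed.

Lemma expg_fracM (G : groupType) (z : G) m n m' n' :
  z ^+ m * z ^- n * (z ^+ m' * z ^- n') = z ^+ (m + m') * z ^- (n + n').
Proof.
have -> : z ^+ m * z ^- n * (z ^+ m' * z ^- n')
  = z ^+ m * (z ^- n * z ^+ m') * z ^- n' by rewrite !mulgA.
rewrite -(commuteV (commute_expg z m' n)) !mulgA -expgnDr -mulgA -invgM.
by rewrite -expgnDr addnC [n' + n]addnC addnC.
Qed.

Lemma expg_fracX (G : groupType) (z : G) m n e :
  (z ^+ m * z ^- n) ^+ e = z ^+ e ^+ m * (z ^+ e) ^- n.
Proof. by rewrite (expgnFl _ (commute_expg z m n)) !(expgnAC _ e). Qed.

(** This is the product of the cyclic group of g with H; the integer exponent is encoded as a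
    difference m - n of naturals. *)
Definition cyclic_ext (G : groupType) (H : G -> Prop) (g x : G) :=
  exists m n, exists2 h, H h & x = g ^+ m * g ^- n * h.

Lemma cyclic_extE (G Q : groupType) (H : G -> Prop)
    (f : UMagmaMorphism.type G Q) g x : (forall x, f x = 1 <-> H x) ->
  cyclic_ext H g x <-> exists m n, f x = f g ^+ m * f g ^- n.
Proof.
move=> fH; split=> [[m [n [h /fH fh ->]]]|[m [n fx]]].
  by exists m, n; rewrite !umulfM fh mulg1 gmulfV !gmulfXn.
exists m, n, ((g ^+ m * g ^- n)^-1 * x); last by rewrite mulVKg.
by apply/fH; rewrite umulfM gmulfV umulfM gmulfV !gmulfXn fx mulVg.
Qed.

Lemma cyclic_ext_nsubgroup (G : groupType) (H : G -> Prop) g :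
  nsubgroup H -> (forall x, H [~ g, x]) -> nsubgroup (cyclic_ext H g).
Proof.
move=> nH cg; have [Q [f [_ fH]]] := nsubgroup_quotient nH.
have cE x := cyclic_extE g x fH.
split=> [|x y|x|x y].
- by apply/cE; exists 0, 0; rewrite gmulf1 divgg.
- move=> /cE[m [n fx]] /cE[m' [n' fy]]; apply/cE.
  by exists (m + m'), (n + n'); rewrite umulfM fx fy expg_fracM.
- move=> /cE[m [n fx]]; apply/cE; exists n, m.
  by rewrite gmulfV fx invgF.
- move=> /cE[m [n fx]]; apply/cE; exists m, n.
  have /eqP/conjg_fixP fgy : [~ f g, f y] = 1.
    by apply/eqP/commgP/(nsubgroup_comm _ _ fH).
  by rewrite gmulfJ fx conjMg conjVg !conjXg fgy.
Qed.

(** The series is built upwards from the trivial subgroup, each new generator being central modulo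
    the previous term in the whole of G. *)
Inductive polycentral (G : groupType) : (G -> Prop) -> Prop :=
| polycentral1 : polycentral (fun x => x = 1)
| polycentral_ext H g : polycentral H -> (forall x, H [~ g, x]) ->
    polycentral (cyclic_ext H g).

Lemma trivial_nsubgroup (G : groupType) : nsubgroup (fun x : G => x = 1).
Proof.
by split=> [|x y -> ->|x ->|x y ->]; rewrite ?mulg1 ?invg1 ?conj1g.
Qed.

Lemma polycentral_nsubgroup (G : groupType) (H : G -> Prop) :
  polycentral H -> nsubgroup H.
Proof.
elim=> [|{}H g _ nH cg]; first exact: trivial_nsubgroup.
exact: cyclic_ext_nsubgroup.
Qed.

Lemma cyclic_ext_sub (G : groupType) (H : G -> Prop) g x :
  H x -> cyclic_ext H g x.
Proof. by move=> Hx; exists 0, 0, x; rewrite ?expg0 ?invg1 ?mul1g. Qed.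

Lemma cyclic_ext_gen (G : groupType) (H : G -> Prop) g :
  nsubgroup H -> cyclic_ext H g g.
Proof.
move=> nH; exists 1%N, 0, 1; first exact: nsub1.
by rewrite divg1 mulg1 expg1.
Qed.

(** The elements central modulo H form a subgroup, and it contains both g and H. *)
Lemma polycentral_comm (G : groupType) (H : G -> Prop) g x y :
  polycentral H -> (forall x, H [~ g, x]) -> cyclic_ext H g x -> H [~ x, y].
Proof.
move=> /polycentral_nsubgroup nH cg; have nC := central_mod_nsubgroup nH.
have CX n : forall x, H [~ g ^+ n, x].
  elim: n => [|n IH]; first by rewrite expg0; apply: (nsub1 nC).
  by rewrite expgS; apply: (nsubM nC).
case=> m [n [h Hh ->]]; apply: (nsubM nC).
  by apply: (nsubM nC) => //; apply: (nsubV nC).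
move=> z; rewrite commgEl; apply: (nsubM nH); last exact: (nsubJ nH).
exact: (nsubV nH).
Qed.

(** * Torsion along a central series *)

Definition torsion (G : groupType) (x : G) := exists2 n, 0 < n & x ^+ n = 1.

Lemma torsionX (G : groupType) (x : G) n : 0 < n -> torsion (x ^+ n) -> torsion x.
Proof.
by move=> n0 [m m0 xm]; exists (n * m)%N; rewrite ?muln_gt0 ?n0 // expgnA.
Qed.

Lemma torsionV (G : groupType) (x : G) : torsion x -> torsion x^-1.
Proof. by case=> n n0 xn; exists n => //; rewrite expVgn xn invg1. Qed.

Lemma torsionJ (G : groupType) (x y : G) : torsion x -> torsion (x ^ y).
Proof. by case=> n n0 xn; exists n => //; rewrite -conjXg xn conj1g. Qed.

Lemma torsion1 (G : groupType) : torsion (1 : G).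
Proof. by exists 1%N. Qed.

Lemma torsion_nsubgroup (G : groupType) (H : G -> Prop) : nsubgroup H ->
  (forall x y, H x -> H y -> torsion x -> torsion y -> torsion (x * y)) ->
  nsubgroup (fun x => torsion x /\ H x).
Proof.
move=> nH tM; split=> [|x y [tx Hx] [ty Hy]|x [tx Hx]|x y [tx Hx]].
- by split; [apply: torsion1|apply: nsub1].
- by split; [apply: tM|apply: nsubM].
- by split; [apply: torsionV|apply: nsubV].
- by split; [apply: torsionJ|apply: nsubJ].
Qed.

(* Both claims are proved together: the commutator bound makes elements commute
   modulo the torsion of the next term, which is a subgroup by the second. *)
Lemma polycentral_torsion (G : groupType) (H : G -> Prop) : polycentral H ->
  (forall c x, H c -> torsion x -> torsion [~ x, c]) /\
  (forall x y, H x -> H y -> torsion x -> torsion y -> torsion (x * y)).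
Proof.
elim=> [|{}H g pH [IHc IHm] cg].
  split=> [c x -> _|x y -> ->]; last by rewrite mulg1.
  by rewrite commg1; apply: torsion1.
have nH := polycentral_nsubgroup pH; have nS := torsion_nsubgroup nH IHm.
have [Q [f [_ fS]]] := nsubgroup_quotient nS.
have tc c x : cyclic_ext H g c -> torsion x -> torsion [~ x, c].
  move=> Hc tx; have [n n0 xn] := tx.
  have Hd : H [~ x, c].
    by rewrite -invgR; apply: (nsubV nH); apply: polycentral_comm Hc.
  have cxd : commute (f x) (f [~ x, c]).
    apply/(nsubgroup_comm _ _ fS); split; first exact: IHc.
    rewrite -invgR [X in X^-1]commgEl; apply: (nsubV nH).
    by apply: (nsubM nH); [apply: nsubV|apply: nsubJ].
  apply: (torsionX n0); suff: f ([~ x, c] ^+ n) = 1 by case/fS.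
  (* The product is the conjugate of x by c. Modulo [S] its factors commute, so its n-th power
     reduces to that of the commutator. *)
  have /(congr1 f): (x * [~ x, c]) ^+ n = 1.
    by rewrite commgEl mulVKg -conjXg xn conj1g.
  by rewrite gmulfXn umulfM expgMn // -!gmulfXn xn gmulf1 mul1g.
split=> // x y Hx Hy tx ty; have [m m0 xm] := tx; have [n n0 yn] := ty.
have cxy : commute (f x) (f y).
  apply/(nsubgroup_comm _ _ fS); split; first exact: tc.
  exact: polycentral_comm Hx.
have mn0 : 0 < m * n by rewrite muln_gt0 m0.
apply: (torsionX mn0); suff: f ((x * y) ^+ (m * n)) = 1 by case/fS.
rewrite gmulfXn umulfM expgMn // -!gmulfXn expgnA xm expg1n mulnC expgnA yn.
by rewrite expg1n !gmulf1 mulg1.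
Qed.

(** The factor generated by g over H is finite or infinite cyclic; the results on exponents and on
    roots split on this. *)
Lemma expg_mod_dichotomy (G Q : groupType) (H : G -> Prop)
    (f : UMagmaMorphism.type G Q) g : (forall x, f x = 1 <-> H x) ->
  (exists2 e, 0 < e & H (g ^+ e)) \/
  (forall m n, f g ^+ m = f g ^+ n -> m = n).
Proof.
move=> fH; have [fin|inf] := pselect (exists2 e, 0 < e & H (g ^+ e)).
  by left.
have ltF m n : f g ^+ m = f g ^+ n -> ~~ (m < n).
  move=> fmn; apply/negP=> mn; apply: inf.
  exists (n - m); first by rewrite subn_gt0.
  by apply/fH; rewrite gmulfXn (expgnFr _ (ltnW mn)) fmn mulgV.
right=> m n fmn; apply/eqP; rewrite eqn_leq.
by apply/andP; split; rewrite leqNgt; apply: ltF.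
Qed.

Lemma cyclic_extX (G : groupType) (H : G -> Prop) g x e : nsubgroup H ->
  H (g ^+ e) -> cyclic_ext H g x -> H (x ^+ e).
Proof.
move=> nH Hge; have [Q [f [_ fH]]] := nsubgroup_quotient nH.
move/(cyclic_extE _ _ fH)=> [m [n fx]]; apply/fH; rewrite gmulfXn fx expg_fracX.
by move/fH: Hge; rewrite gmulfXn => ->; rewrite !expg1n mulgV.
Qed.

Lemma expg_frac1 (G : groupType) (z : G) m n :
  z ^+ m * z ^- n = 1 -> z ^+ m = z ^+ n.
Proof. by move/divg1_eq. Qed.

Lemma expg_fracI (G : groupType) (z : G) m n m' n' :
  z ^+ m * z ^- n = z ^+ m' * z ^- n' -> z ^+ (m + n') = z ^+ (m' + n).
Proof.
move=> E; rewrite !expgnDr -(mulgVK (z ^+ n) (z ^+ m)) E -mulgA -(expgnDr z n n').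
by rewrite [(n + n')%N]addnC (expgnDr z n' n) mulgA mulgVK.
Qed.

(** If g ^ e lies in H, the exponent is multiplied by e. An infinite cyclic factor is torsion-free,
    so the torsion already lies in H. *)
Lemma torsion_exponent (G : groupType) (H : G -> Prop) : polycentral H ->
  exists2 E, 0 < E & forall t, H t -> torsion t -> t ^+ E = 1.
Proof.
elim=> [|{}H g pH [E E0 HE] cg]; first by exists 1%N => // t -> _; rewrite expg1.
have nH := polycentral_nsubgroup pH; have [Q [f [_ fH]]] := nsubgroup_quotient nH.
have [[e e0 Hge]|inf] := expg_mod_dichotomy g fH.
  exists (e * E)%N => [|t Ht [n n0 tn]]; first by rewrite muln_gt0 e0.
  rewrite expgnA HE //; first exact: cyclic_extX Ht.
  by exists n => //; rewrite expgnAC tn expg1n.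
exists E => // t /(cyclic_extE _ _ fH)[a [b ft]] tt; apply: HE => //.
have [n n0 tn] := tt; apply/fH; rewrite ft.
have /(congr1 f) := tn; rewrite gmulfXn ft expg_fracX gmulf1 -!expgnA.
move/expg_frac1/inf/eqP; rewrite eqn_pmul2l // => /eqP ->.
by rewrite mulgV.
Qed.

(** Modulo the torsion of the previous term H, t commutes with u, so (u t)^E = u^E s with s torsion
    in H. The induction hypothesis for u^E then absorbs s. *)
Lemma torsion_power_absorb (G : groupType) (H : G -> Prop) E : polycentral H ->
  (forall t : G, torsion t -> t ^+ E = 1) ->
  nsubgroup (@torsion G) ->
  exists k, forall u t, H t -> torsion t -> (u * t) ^+ (E ^ k) = u ^+ (E ^ k).
Proof.
move=> pH tE nT; elim: pH => [|{}H g pH [k Hk] cg].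
  by exists 0 => u t -> _; rewrite mulg1.
have nH := polycentral_nsubgroup pH.
have nS := torsion_nsubgroup nH (fun x y _ _ => @nsubM _ _ nT x y).
have [Q [f [_ fS]]] := nsubgroup_quotient nS.
exists k.+1 => u t Ht tt.
have ctu : commute (f u) (f t).
  apply/commute_sym/(nsubgroup_comm _ _ fS).
  split; last exact: polycentral_comm Ht.
  by rewrite commgEl; apply: (nsubM nT); [apply: torsionV|apply: torsionJ].
have [ts Hs] : torsion (u ^- E * (u * t) ^+ E) /\ H (u ^- E * (u * t) ^+ E).
  apply/fS; rewrite umulfM gmulfV !gmulfXn umulfM expgMn // -[f t ^+ E]gmulfXn tE //.
  by rewrite gmulf1 mulg1 mulVg.
rewrite expnS !expgnA -(Hk (u ^+ E) _ Hs ts).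
by rewrite mulVKg.
Qed.

(** If g ^ e lies in H, pass to w ^ e. In an infinite cyclic factor only 0 is divisible by every q ^
    m, so w and all its roots fall into H. *)
Lemma roots_torsion (G : groupType) (H : G -> Prop) q w : polycentral H ->
  1 < q -> (forall m, exists2 z, H z & z ^+ (q ^ m) = w) -> torsion w.
Proof.
move=> pH q1; elim: pH w => [|{}H g pH IH cg] w rw.
  by have [z -> <-] := rw 0; rewrite expg1n; apply: torsion1.
have nH := polycentral_nsubgroup pH; have [Q [f [_ fH]]] := nsubgroup_quotient nH.
have [[e e0 Hge]|inf] := expg_mod_dichotomy g fH.
  apply: (torsionX e0); apply: IH => m; have [z Hz <-] := rw m.
  by exists (z ^+ e); [apply: cyclic_extX Hz|rewrite expgnAC].
apply: IH; have [w' Hw'] := rw 0; rewrite expn0 expg1 => ww'.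
rewrite {}ww' in Hw'; have [a [b fw]] := (cyclic_extE _ _ fH).1 Hw'.
have root m z c d : z ^+ (q ^ m) = w -> f z = f g ^+ c * f g ^- d ->
    (c * q ^ m + b = a + d * q ^ m)%N.
  move=> zw fz; apply: inf.
  move/(congr1 f): zw; rewrite gmulfXn fz fw expg_fracX -!expgnA => /expg_fracI.
  by rewrite ![(q ^ m * _)%N]mulnC.
have ab : a = b.
  (* With m = a + b, q ^ m exceeds a + b and hence |a - b|, while it divides a - b. *)
  have [z /(cyclic_extE _ _ fH)[c [d fz]] zw] := rw (a + b).
  have := root _ _ _ _ zw fz; have := ltn_expl (a + b) q1.
  set r := (q ^ _)%N => ltr E.
  have [cd|cd|cd] := ltngtP c d; last first.
  - by move: E; rewrite cd addnC => /addIn.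
  - have : (d * r + r <= c * r)%N by rewrite -mulSnr leq_mul2r cd orbT.
    by lia.
  have : (c * r + r <= d * r)%N by rewrite -mulSnr leq_mul2r cd orbT.
  by lia.
move=> m; have [z Hz zw] := rw m; exists z => //.
have [c [d fz]] := (cyclic_extE _ _ fH).1 Hz.
have := root _ _ _ _ zw fz; rewrite ab addnC => /addnI/eqP.
rewrite eqn_pmul2r ?expn_gt0 ?(ltnW q1) // => /eqP cd.
by apply/fH; rewrite fz cd mulgV.
Qed.

(** * Subgroups of finite index *)

Lemma expg_frac_mod (G : groupType) (z : G) e m n : 0 < e -> z ^+ e = 1 ->
  exists2 i, i < e & z ^+ m * z ^- n = z ^+ i.
Proof.
move=> e0 ze; have red k : z ^+ k = z ^+ (k %% e).
  by rewrite {1}(divn_eq k e) expgnDr mulnC expgnA ze expg1n mul1g.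
(* Modulo e, -n is congruent to n (e - 1). *)
exists ((m + n * e.-1) %% e); first by rewrite ltn_mod.
rewrite -red expgnDr; congr (_ * _).
apply: (mulIg (z ^+ n)); rewrite mulVg -expgnDr -mulnSr prednK //.
by rewrite mulnC expgnA ze expg1n.
Qed.

(** Modulo N each cyclic factor is finite, so products of the g ^ i, i < e, with representatives for
    the previous term suffice. *)
Lemma finite_index (G : groupType) (H N : G -> Prop) : polycentral H ->
  nsubgroup N -> (forall x, exists2 e, 0 < e & N (x ^+ e)) ->
  exists R : seq G, forall x, H x -> exists2 r, r \in R & N (r^-1 * x).
Proof.
move=> pH nN; have [Q [f [_ fN]]] := nsubgroup_quotient nN.
move=> powN; elim: pH => [|{}H g pH [R RH] cg].
  exists [:: 1] => x ->; exists 1; first by rewrite inE.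
  by rewrite mulVg; apply: nsub1.
have [e e0 /fN fge] := powN g; rewrite gmulfXn in fge.
exists [seq g ^+ i * r | i <- iota 0 e, r <- R] => x [m [n [h Hh ->]]].
have [i ie fi] := expg_frac_mod m n e0 fge.
have [r Rr /fN frh] := RH h Hh.
exists (g ^+ i * r); first by apply: allpairs_f => //; rewrite mem_iota.
apply/fN; rewrite !(umulfM, gmulfV, gmulfXn) fi invgM -!mulgA mulKg.
by rewrite -gmulfV -umulfM.
Qed.

(** * Finitely generated nilpotent groups *)

Lemma polycentral_adjoin (G : groupType) (l : seq G) (H : G -> Prop) :
  polycentral H -> (forall u, u \in l -> forall x, H [~ u, x]) ->
  exists2 H', polycentral H' & forall u, H u \/ u \in l -> H' u.
Proof.
elim: l H => [|g l IH] H pH cl; first by exists H => // u [].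
have cg := cl g (mem_head _ _).
have [|H' pH' H'l] := IH _ (polycentral_ext pH cg).
  by move=> u ul x; apply/cyclic_ext_sub/cl; rewrite inE ul orbT.
exists H' => // u [Hu|]; first by apply: H'l; left; apply: cyclic_ext_sub.
rewrite inE => /predU1P[->|ul]; apply: H'l; [left|by right].
exact/cyclic_ext_gen/polycentral_nsubgroup.
Qed.

Fixpoint left_comm (G : groupType) (x : nat -> G) n :=
  if n is n'.+1 then [~ left_comm x n', x n] else x 0.

Lemma left_comm_ext (G : groupType) (x y : nat -> G) n :
  (forall i, i <= n -> x i = y i) -> left_comm x n = left_comm y n.
Proof.
elim: n => [|n IH] xy /=; first exact: xy.
by rewrite IH ?xy // => i le_in; apply: xy; apply: leqW.
Qed.

Lemma left_commS (G : groupType) (x : nat -> G) n v :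
  exists y, left_comm y n.+1 = [~ left_comm x n, v].
Proof.
exists (fun i => if i <= n then x i else v); rewrite /= ltnn.
by congr [~ _, _]; apply: left_comm_ext => i ->.
Qed.

(** [L n] lists the left-normed commutators of weight n + 1 in the generators. Starting from [L c],
    which is trivial, the lists are adjoined down to [L 0 = s]. An entry u of one list commutes with
    each generator modulo the term containing the next list, hence with all of G, since its
    centralizer there is a subgroup. *)
Lemma fg_nilpotent_polycentral (G : groupType) (s : seq G) c :
  (forall S : G -> Prop, S 1 -> (forall x y, S x -> S y -> S (x * y)) ->
     (forall x, S x -> S x^-1) -> (forall x, x \in s -> S x) -> forall x, S x) ->
  (forall x : nat -> G, left_comm x c = 1) ->
  exists2 H : G -> Prop, polycentral H & forall x, H x.
Proof.
move=> gen nil.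
pose L := fix L n := if n is n'.+1 then [seq [~ u, v] | u <- L n', v <- s] else s.
have LE n u : u \in L n -> exists x, u = left_comm x n.
  elim: n u => [|n IH] u; first by exists (fun=> u).
  case/allpairsP=> -[u' v] /= [/IH[x ->] _ ->].
  by have [y] := left_commS x n v; exists y.
have LH k : k <= c -> exists2 H, polycentral H & forall u, u \in L (c - k) -> H u.
  elim: k => [|k IH] kc.
    exists (fun x => x = 1); first exact: polycentral1.
    by move=> u; rewrite subn0 => /LE[x ->].
  have [H pH HL] := IH (ltnW kc); have nH := polycentral_nsubgroup pH.
  have [|H' pH' H'L] := @polycentral_adjoin _ (L (c - k.+1)) H pH; last first.
    by exists H' => // u uL; apply: H'L; right.
  move=> u uL; have [Q [f [_ fH]]] := nsubgroup_quotient nH.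
  suff cu x : commute (f u) (f x) by move=> x; apply/(nsubgroup_comm _ _ fH).
  apply: (gen (fun x => commute (f u) (f x))) => [|x1 x2 c1 c2|x1 c1|x1 xs].
  - by rewrite gmulf1; apply: commute1.
  - by rewrite umulfM; apply: commuteM.
  - by rewrite gmulfV; apply: commuteV.
  apply/(nsubgroup_comm _ _ fH)/HL.
  by rewrite -(subnSK kc); apply: allpairs_f.
have [H pH HL] := LH c (leqnn c); exists H => //.
rewrite subnn in HL; have nH := polycentral_nsubgroup pH.
by apply: gen; [apply: nsub1|apply: nsubM|apply: nsubV|].
Qed.

(** * Elements of p-power order *)

Lemma expg_gcdn (G : groupType) (x : G) m n : 0 < m ->
  x ^+ m = 1 -> x ^+ n = 1 -> x ^+ gcdn m n = 1.
Proof.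
move=> m0 xm xn; case: (egcdnP n m0) => km kn E _.
have : x ^+ (km * m) = 1 by rewrite mulnC expgnA xm expg1n.
by rewrite E expgnDr mulnC expgnA xn expg1n mul1g.
Qed.

(** The gcd of E and p ^ j is a power of p dividing E, hence divides p ^ [logn p E]. *)
Lemma expg_logn (G : groupType) (x : G) p E j : prime p -> 0 < E ->
  x ^+ E = 1 -> x ^+ (p ^ j) = 1 -> x ^+ (p ^ logn p E) = 1.
Proof.
move=> pp E0 xE xj; have := expg_gcdn E0 xE xj.
have /(dvdn_pfactor _ _ pp)[i _ gE] := dvdn_gcdr E (p ^ j).
rewrite gE => xi; have : p ^ i %| E by rewrite -gE dvdn_gcdl.
rewrite pfactor_dvdn // => /subnKC <-.
by rewrite expnD expgnA xi expg1n.
Qed.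

Lemma order_pgroup (gT : finGroupType) p : prime p ->
  (forall y : gT, exists i, y ^+ (p ^ i) = 1) -> pgroup p [set: gT].
Proof.
move=> pp yp; apply/pgroupP=> q pq /(Cauchy pq)[y _ oy].
have [i /eqP] := yp y; rewrite -order_dvdn oy Euclid_dvdX // => /andP[].
by rewrite dvdn_prime2.
Qed.

(** * Sufficiency: p-primary torsion and torsion commutators give separability *)

Definition conj_p_separable (G : groupType) p := forall a b : G,
  ~ (exists g, a ^ g = b) ->
  exists (gT : finGroupType) (f : G -> gT),
    [/\ {morph f : x y / x * y >-> x * y}, forall y, exists x, f x = y,
        pgroup p [set: gT] & ~ (exists z, f a ^ z = f b)].

Definition central (G : groupType) (z : G) := forall y, commute z y.

Lemma central_nsubgroup (G : groupType) : nsubgroup (@central G).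
Proof.
split=> [y|x y cx cy z|x cx y|x y cx].
- exact/commute_sym/commute1.
- by apply/commute_sym/commuteM; apply/commute_sym.
- exact/commute_sym/commuteV/commute_sym.
- by have /commgP/conjg_fixP -> := cx y.
Qed.

Lemma centralX (G : groupType) (z : G) n : central z -> central (z ^+ n).
Proof.
move=> cz; have cN := central_nsubgroup G.
by elim: n => [|n IH]; [apply: (nsub1 cN)|rewrite expgS; apply: (nsubM cN)].
Qed.

(** Conjugating by y, (u ^ n)^y = (u [u, y])^n, and the torsion factor [u, y] is absorbed. *)
Lemma absorb_central (G : groupType) n (u : G) :
  (forall u t : G, torsion t -> (u * t) ^+ n = u ^+ n) ->
  (forall y, torsion [~ u, y]) -> central (u ^+ n).
Proof.
move=> abs tu y; apply/commgP/conjg_fixP.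
by rewrite conjXg -(mulVKg u (u ^ y)) -commgEl abs.
Qed.

Lemma central_root_nsubgroup (G : groupType) n :
  nsubgroup (fun x : G => exists2 z, central z & z ^+ n = x).
Proof.
have cN := central_nsubgroup G.
split=> [|x y [z cz <-] [t ct <-]|x [z cz <-]|x y [z cz <-]].
- by exists 1; [exact: (nsub1 cN)|rewrite expg1n].
- by exists (z * t); [exact: (nsubM cN)|rewrite expgMn].
- by exists z^-1; [exact: (nsubV cN)|rewrite expVgn].
- by exists (z ^ y); [exact: (nsubJ cN)|rewrite conjXg].
Qed.

Lemma torsion_p_exponent (G : groupType) (H : G -> Prop) p : prime p ->
  polycentral H -> (forall x, H x) ->
  (forall x : G, torsion x -> exists k, x ^+ (p ^ k) = 1) ->
  exists K, forall t : G, torsion t -> t ^+ (p ^ K) = 1.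
Proof.
move=> pp pH full tp; have [E E0 HE] := torsion_exponent pH.
exists (logn p E) => t tt; have [j tj] := tp t tt.
exact: (expg_logn pp E0 (HE _ _ _) tj).
Qed.

Lemma torsion_full_nsubgroup (G : groupType) (H : G -> Prop) :
  polycentral H -> (forall x, H x) -> nsubgroup (@torsion G).
Proof.
move=> pH full; have [_ tM] := polycentral_torsion pH.
split=> [|x y tx ty|x|x y]; first exact: torsion1.
- exact: tM.
- exact: torsionV.
- exact: torsionJ.
Qed.

Lemma uniform_avoid (G : groupType) (N : nat -> G -> Prop) (R : seq G) :
  (forall m n x, m <= n -> N n x -> N m x) ->
  (forall x, x \in R -> exists m, ~ N m x) ->
  exists m, forall x, x \in R -> ~ N m x.
Proof.
move=> Ndec; elim: R => [|y R IH] av; first by exists 0.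
have [|m Hm] := IH; first by move=> x xR; apply: av; rewrite inE xR orbT.
have [n Hn] := av y (mem_head _ _).
exists (maxn m n) => x; rewrite inE => /predU1P[->|xR] Nx.
  by apply: Hn; apply: Ndec Nx; apply: leq_maxr.
by apply: (Hm _ xR); apply: Ndec Nx; apply: leq_maxl.
Qed.

Lemma torsion_p_abelian_separable (G : groupType) (H : G -> Prop) p : prime p ->
  polycentral H -> (forall x, H x) ->
  (forall x : G, torsion x -> exists k, x ^+ (p ^ k) = 1) ->
  (forall x y : G, torsion [~ x, y]) -> conj_p_separable G p.
Proof.
move=> pp pH full tp tc a b ab.
have p0 : 0 < p := prime_gt0 pp.
have nT := torsion_full_nsubgroup pH full.
have [K tK] := torsion_p_exponent pp pH full tp.
have [k Hk] := torsion_power_absorb pH tK nT.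
set n := ((p ^ K) ^ k)%N in Hk; have n0 : 0 < n by rewrite !expn_gt0 p0.
have cX (x : G) : central (x ^+ n).
  exact: absorb_central (fun u t => Hk u t (full t)) (tc x).
(* Since R represents all cosets of the centre, the a ^ r with r in R are all the conjugates of
   a. *)
have [R HR] := finite_index pH (central_nsubgroup G)
  (fun x => ex_intro2 _ _ n n0 (cX x)).
pose N m (x : G) := exists2 z, central z & z ^+ (p ^ m) = x.
have Ndec m m' x : m <= m' -> N m' x -> N m x.
  move=> /subnKC <- [z cz <-]; exists (z ^+ (p ^ (m' - m))).
    exact: centralX.
  by rewrite -expgnA -expnD addnC.
have Nsep w : w <> 1 -> exists m, ~ N m w.
  move=> w1; apply: contrapT => /forallNP allN; apply: w1.
  have {}allN m : N m w by apply: contrapT.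
  have tw : torsion w.
    apply: (roots_torsion pH (prime_gt1 pp)) => m.
    by have [z _ zw] := allN m; exists z.
  (* The root z is itself torsion, so w = z ^ (p ^ K) = 1. *)
  have [z _ zw] := allN K; rewrite -zw tK //.
  by apply: (@torsionX _ _ (p ^ K)); rewrite ?expn_gt0 ?p0 // zw.
have [|M HM] := @uniform_avoid _ N [seq (a ^ r)^-1 * b | r <- R] Ndec.
  move=> _ /mapP[r _ ->]; apply: Nsep => E; apply: ab; exists r.
  by rewrite -[RHS](mulVKg (a ^ r)) E mulg1.
have nN : nsubgroup (N M) := @central_root_nsubgroup G (p ^ M)%N.
have [Q [f [fs fN]]] := nsubgroup_quotient nN.
(* The exponent of G / [N M] divides n p ^ M, a power of p; this yields both finiteness and the
   p-group property. *)
have fX x : f (x ^+ (n * p ^ M)) = 1.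
  by apply/fN; exists (x ^+ n); rewrite ?expgnA.
have nM0 : 0 < n * p ^ M by rewrite muln_gt0 n0 expn_gt0 p0.
have [R' HR'] := finite_index pH nN
  (fun x => ex_intro2 _ _ (n * p ^ M)%N nM0 ((fN (x ^+ _)).1 (fX x))).
have [|gT [h [hM hB]]] := @finGroupType_of Q (map f R').
  move=> q; have [x <-] := fs q; have [r rR' /fN fr] := HR' x (full x).
  rewrite -(mulVKg r x) umulfM fr mulg1; exact: map_f.
have hI := bij_inj hB.
have h1 : h 1 = 1 by apply: (mulgI (h 1)); rewrite -hM !mulg1.
have hX x i : h (x ^+ i) = h x ^+ i.
  by elim: i => [|i IH]; rewrite ?expg0 // !expgS hM IH.
exists gT, (h \o f); split=> [x y|y||[z]] /=.
- by rewrite umulfM hM.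
- have [h' _ h'K] := hB; have [x fx] := fs (h' y); exists x.
  by rewrite fx h'K.
(* Here n = p ^ (K k). *)
- apply: order_pgroup => // y; exists (K * k + M)%N.
  have [h' _ h'K] := hB; have [x fx] := fs (h' y).
  by rewrite -(h'K y) -fx -hX -gmulfXn expnD expnM fX h1.
have [h' _ h'K] := hB; have [x fx] := fs (h' z).
rewrite -(h'K z) -fx conjgE => E.
have {}E : h (f a * f x) = h (f x * f b).
  by rewrite !hM -E mulVKg.
have {}E : N M ((a ^ x)^-1 * b).
  apply/fN; rewrite umulfM gmulfV gmulfJ conjgE (hI _ _ E) mulKg.
  exact: mulVg.
have [r rR cr] := HR x (full x).
apply: (HM ((a ^ r)^-1 * b)); first exact: map_f.
(* x and r differ by a central factor. *)
have -> // : a ^ r = a ^ x.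
rewrite -(mulVKg r x) conjgM.
have /commute_sym/commgP/conjg_fixP -> // := cr (a ^ r).
Qed.

(** * Necessity: separability forces p-primary torsion and torsion commutators *)

Lemma coprime_expg_inverse (p q : nat) (gT : finGroupType) (w : gT) :
  pgroup p [set: gT] -> prime p -> coprime p q -> 0 < q ->
  exists r, w ^+ (r * q) = w.
Proof.
move=> pG pp cpq q0; have /p_natP[i oi] : p.-nat #|[set: gT]| by [].
have w1 : w ^+ (p ^ i) = 1.
  by apply/eqP; rewrite -order_dvdn -oi order_dvdG ?inE.
have [r k E _] := egcdnP (p ^ i) q0.
exists r; rewrite E; move/eqP: (coprimeXl i cpq); rewrite gcdnC => ->.
by rewrite expgnDr mulnC expgnA w1 expg1n mul1g.
Qed.

(** Write n = m p ^ l with m prime to p. The m-th power of y = x ^ (p ^ l) is 1, so y dies in every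
    finite p-group and cannot be separated from 1. *)
Lemma separable_torsion_p (G : groupType) p (x : G) : prime p ->
  conj_p_separable G p -> torsion x -> exists k, x ^+ (p ^ k) = 1.
Proof.
move=> pp sep [n n0 xn]; exists (logn p n); apply: contrapT => y1.
have [|gT [f [fM _ pG []]]] := sep (x ^+ (p ^ logn p n)) 1.
  move=> [g /eqP]; rewrite conjg_eq1 => /eqP; exact: y1.
have f1 : f 1 = 1 by apply: (mulgI (f 1)); rewrite -fM !mulg1.
have fX y i : f (y ^+ i) = f y ^+ i.
  by elim: i => [|i IH]; rewrite ?expg0 // !expgS fM IH.
exists 1; rewrite conjg1 f1; set y := f _.
have [[|m] cpm nE] := pfactor_coprime pp n0; first by rewrite nE in n0.
have [r <-] := coprime_expg_inverse y pG pp cpm (ltn0Sn m).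
by rewrite mulnC expgnA -fX -expgnA mulnC -nE xn f1 expg1n.
Qed.

(** Centrality makes g -> [v, g] a homomorphism, and the conjugates of v ^ q are exactly the v ^ q
    [v, h]^q. *)
Lemma separable_bicentral_torsion (G : groupType) (H : G -> Prop) p (v : G) :
  prime p -> polycentral H -> (forall x, H x) -> conj_p_separable G p ->
  (forall g, central [~ v, g]) -> forall g, torsion [~ v, g].
Proof.
move=> pp pH full sep cv g0; pose q := p.+1.
have cpq : coprime p q by apply: coprimenS.
have commM g h : [~ v, g * h] = [~ v, g] * [~ v, h].
  have /commgP/conjg_fixP E := cv g h.
  rewrite commgEl conjgM -(mulVKg v (v ^ g)) -commgEl conjMg E.
  by rewrite mulgA -commgEl cv.
have commX g n : [~ v, g ^+ n] = [~ v, g] ^+ n.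
  by elim: n => [|n IH]; rewrite ?expg0 ?commg1 // !expgS commM IH.
have XJ g : (v ^+ q) ^ g = v ^+ q * [~ v, g] ^+ q.
  by rewrite conjXg -(mulVKg v (v ^ g)) -commgEl expgMn //; apply/commute_sym/cv.
have [[g ng]|/forallNP div] :=
  pselect (exists g, forall h, [~ v, g] <> [~ v, h] ^+ q); last first.
  have {}div g : exists h, [~ v, h] ^+ q = [~ v, g].
    apply: contrapT => /forallNP ndiv; apply: (div g) => h E; exact: (ndiv h).
  apply: (roots_torsion pH (prime_gt0 pp : 1 < q)) => m.
  suff [h hE] : exists h, [~ v, h] ^+ (q ^ m) = [~ v, g0] by exists [~ v, h].
  elim: m => [|m [h <-]]; first by exists g0; rewrite expn0 expg1.
  have [h' <-] := div h; exists h'.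
  by rewrite expnS expgnA.
have [[h]|gT [f [fM _ pG []]]] := sep (v ^+ q) (v ^+ q * [~ v, g]).
  by rewrite XJ => /mulgI/esym; apply: ng.
have f1 : f 1 = 1 by apply: (mulgI (f 1)); rewrite -fM !mulg1.
have fX y i : f (y ^+ i) = f y ^+ i.
  by elim: i => [|i IH]; rewrite ?expg0 // !expgS fM IH.
have [r rE] := coprime_expg_inverse (f [~ v, g]) pG pp cpq (ltn0Sn p).
(* Conjugation by g ^ r sends v ^ q to v ^ q [v, g]^(r q), and r inverts q modulo the order of f
   [v, g]. *)
exists (f (g ^+ r)); apply: (mulgI (f (g ^+ r))).
rewrite conjgE mulVKg -!fM conjgC XJ commX -expgnA fM [RHS]fM.
rewrite [X in _ * X]fM [X in _ = _ * X]fM [f (_ ^+ (r * q))]fX rE.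
by [].
Qed.

(** Modulo torsion, the second centre is shown to equal the centre, so the nilpotency class drops
    until G is abelian modulo torsion. *)
Lemma separable_commutator_torsion (G : groupType) (H : G -> Prop) p c :
  prime p -> polycentral H -> (forall x, H x) ->
  (forall x : nat -> G, left_comm x c = 1) -> conj_p_separable G p ->
  forall x y : G, torsion [~ x, y].
Proof.
move=> pp pH full nil sep.
have nT := torsion_full_nsubgroup pH full.
have [K tK] := torsion_p_exponent pp pH full
  (fun x => @separable_torsion_p _ _ x pp sep).
have [k Hk] := torsion_power_absorb pH tK nT.
set n := ((p ^ K) ^ k)%N in Hk.
have n0 : 0 < n by rewrite !expn_gt0 prime_gt0.
have abs (u t : G) : torsion t -> (u * t) ^+ n = u ^+ n by apply: Hk.
have [Q [f [_ fT]]] := nsubgroup_quotient nT.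
have second_center (u : G) : (forall g h, torsion [~ [~ u, g], h]) ->
    forall g, torsion [~ u, g].
  move=> tu; have cX g : central ([~ u, g] ^+ n) by apply: absorb_central (tu g).
  (* The first n-th power gives (u ^ n)^g = u ^ n [u, g]^n t with t torsion and [u, g]^n central;
     the second absorbs t. So u ^ (n n) is a valid v for [separable_bicentral_torsion]. *)
  have XE g : [~ u ^+ n ^+ n, g] = [~ u, g] ^+ n ^+ n.
    have ts : torsion (([~ u, g] ^+ n)^-1 * (u ^- n * (u * [~ u, g]) ^+ n)).
      have : commute (f u) (f [~ u, g]).
        exact/commute_sym/(nsubgroup_comm _ _ fT)/tu.
      move: [~ u, g] => c' uc'; apply/fT.
      by rewrite !(umulfM, gmulfV, gmulfXn) expgMn // mulKg mulVg.
    rewrite commgEl !conjXg -[u ^ g](mulVKg u) -commgEl.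
    rewrite -[(u * _) ^+ n](mulVKg (u ^+ n)) -[u ^- n * _](mulVKg ([~ u, g] ^+ n)).
    rewrite mulgA (abs _ _ ts) expgMn ?mulKg //.
    exact/commute_sym/cX.
  move=> g; apply: (torsionX n0); apply: (torsionX n0); rewrite -XE.
  apply: (separable_bicentral_torsion pp pH full sep) => h; rewrite XE.
  exact/centralX/cX.
(* Index (c - d) + 1 means weight c - d + 2: d = 0 is trivial by nilpotency, and d = c gives the
   ordinary commutators. *)
have tl d (x : nat -> G) : torsion (left_comm x (c - d).+1).
  elim: d x => [|d IH] x.
    by rewrite subn0 /= nil comm1g; apply: torsion1.
  have [cd|cd] := leqP c d.
    have := IH x; by rewrite (eqP cd) (eqP (leqW cd)).
  rewrite /=; apply: second_center => g h.
  have [y yE] := left_commS x (c - d.+1) g; rewrite -yE subnSK //.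
  have [z <-] := left_commS y (c - d) h; exact: IH.
move=> x y; have := tl c (fun i => if i is 0 then x else y).
by rewrite subnn.
Qed.

(** * Translation to the stated definitions, and the theorem *)

Lemma expg_gpow (G : Grp) (x : G) n : gpow x n = x ^+ n.
Proof. by elim: n => [|n IH] //=; rewrite expgS -IH. Qed.

Lemma torsion_eltE (G : Grp) (x : G) :
  torsion_elt x <-> torsion x.
Proof.
split=> [[n [n0 xn]]|[n n0 xn]]; exists n; rewrite -?expg_gpow //.
by rewrite expg_gpow.
Qed.

Lemma gcommE (G : Grp) (x y : G) :
  gcomm x y = [~ x, y].
Proof. by rewrite /commg /conjg mulgA. Qed.

Lemma conj_inE (G : Grp) (x y : G) :
  conj_in x y <-> exists g : G, x ^ g = y.
Proof.
by split=> [[g E]|[g E]]; exists g; move: E; rewrite conjgE mulgA.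
Qed.

Lemma lcommE (G : Grp) (x : nat -> G) n :
  lcomm x n = left_comm  x n.
Proof. by elim: n => [|n IH] //=; rewrite gcommE IH. Qed.

Lemma In_mem (T : eqType) (x : T) s : List.In x s -> x \in s.
Proof.
elim: s => //= y s IH [->|/IH xs]; rewrite inE ?eqxx // xs.
exact: orbT.
Qed.

Lemma conj_Fp_separableE (G : Grp) p :
  conj_Fp_separable G p <-> conj_p_separable (G) p.
Proof.
split=> sep a b nab.
  have [|gT [f [fM fs pG nf]]] := sep a b; first by rewrite conj_inE.
  by exists gT, f.
have [|gT [f [fM fs pG nf]]] := sep a b; first by rewrite -conj_inE.
by exists gT, f.
Qed.

Theorem mainTheorem1 (p : nat) (G : Grp) :
  prime p -> fin_gen G -> nilpotent_grp G ->
  (conj_Fp_separable G p <-> torsion_pgroup G p /\ abelian_mod_torsion G).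
Proof.
move=> pp [s sG] [c nilG].
have nil (x : nat -> G) : left_comm x c = 1.
  by rewrite -lcommE nilG.
have [|H pH full] := @fg_nilpotent_polycentral G s c _ nil.
  move=> S S1 SM SV sS x; elim: (sG x) => [y /In_mem/sS|//|y z _ Sy _ Sz|y _ /SV //] //.
  exact: SM.
rewrite conj_Fp_separableE; split=> [sep|[tp ab]].
  split=> [x /torsion_eltE tx|x y].
    have [k xk] := separable_torsion_p pp sep tx.
    by exists k; rewrite expg_gpow.
  apply/torsion_eltE; rewrite gcommE.
  exact: (separable_commutator_torsion pp pH full nil sep).
apply: (torsion_p_abelian_separable pp pH full) => [x /torsion_eltE/tp[k]|x y].
  by rewrite expg_gpow; exists k.
by rewrite -gcommE; apply/torsion_eltE.
Qed.
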